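(* Let $\mathcal{C}^n=(M^n,K(x,p))$, $n\ge 4$, be an $m$-th root Cartan space, $m\ge 4$, with metric $K(x,p)=\sqrt[m]{a^{i_1i_2\ldots i_m}(x)p_{i_1}p_{i_2}\cdots p_{i_m}}$, and suppose that the matrix $(a^{ij})$ is invertible. Then the $T$-tensor $T^{hijk}$ of $\mathcal{C}^n$ is given on $T^*M\setminus\{0\}$ by $$\begin{aligned}T^{hijk}={}&-\frac{(m-1)(m-2)(m-3)}{2K}a^{hijk}+\frac{(m-1)(m-2)^2}{4K}\left(a_r^{hk}a^{rij}+a_r^{ik}a^{rhj}+a_r^{jk}a^{rhi}\right)\\&-\frac{m(m-1)(m-2)}{4K}\left(a^{hij}a^k+a^{hjk}a^i+a^{ijk}a^h+a^{hik}a^j-a^{ij}a^{hk}-a^{hj}a^{ik}-a^{ih}a^{jk}\right).\end{aligned}$$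
   Context: The summation convention is used; indices (including the index $h$) run over $1,\dots,n$; $(x^i,p_i)$ are the induced local coordinates on the cotangent bundle $T^*M$ of an $n$-dimensional smooth manifold $M$; $\dot\partial^i=\partial/\partial p_i$. A Cartan space $(M^n,K(x,p))$ is a manifold $M$ with a real function $K$ on $T^*M$ which is positive and differentiable (smooth) on $T^*M\setminus\{0\}$, continuous on the null section, positively $1$-homogeneous in the momenta $p_i$, and such that the matrix $g^{ij}(x,p)=\frac12\dot\partial^i\dot\partial^jK^2$ is positive definite on $T^*M\setminus\{0\}$. It is an $m$-th root Cartan space if $K(x,p)=\sqrt[m]{a^{i_1\ldots i_m}(x)p_{i_1}\cdots p_{i_m}}$, where $a^{i_1\ldots i_m}(x)$ depends on the position only and is symmetric in all its indices. Notation: $a^i=\left[a^{ii_2\ldots i_m}(x)p_{i_2}\cdots p_{i_m}\right]/K^{m-1}$, $a^{ij}=\left[a^{iji_3\ldots i_m}(x)p_{i_3}\cdots p_{i_m}\right]/K^{m-2}$, $a^{ijk}=\left[a^{ijki_4\ldots i_m}(x)p_{i_4}\cdots p_{i_m}\right]/K^{m-3}$, $a^{hijk}=\left[a^{hijki_5\ldots i_m}(x)p_{i_5}\cdots p_{i_m}\right]/K^{m-4}$. The matrix $(a_{ij})$ is the inverse of $(a^{ij})$, and $a_i^{jk}=a_{is}a^{sjk}$. The matrix $(g_{ij})$ is the inverse of $(g^{ij})$. Further, $l^i=\dot\partial^iK$, $C^{ijk}=-\frac12\dot\partial^kg^{ij}$, and $C_i^{jk}=g_{is}C^{sjk}$.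 The $T$-tensor is defined by $$T^{hijk}=K\,C^{hij}|^k+l^hC^{ijk}+l^iC^{jkh}+l^jC^{khi}+l^kC^{hij},$$ where $|^k$ is the local $v$-covariant derivation of the Cartan canonical connection, i.e. $$C^{hij}|^k=\dot\partial^kC^{hij}+C^{rij}C_r^{hk}+C^{hrj}C_r^{ik}+C^{hir}C_r^{jk}.$$ *)

(* Defs.v *)
From HB Require Import structures.
From mathcomp Require Import all_boot all_order all_algebra.
From mathcomp Require Import all_classical all_reals all_analysis.

Set Implicit Arguments.
Unset Strict Implicit.
Unset Printing Implicit Defensive.

Import Order.TTheory GRing.Theory Num.Theory.
Import numFieldNormedType.Exports.

Local Open Scope classical_set_scope.
Local Open Scope ring_scope.

(* C^oo on an open set U of a finite-dimensional space V: every iterated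
   directional derivative of f is (Frechet) differentiable at every point of U.
   Only meaningful for U open. *)
Definition smooth_on (R : realType) (V W : normedModType R) (U : set V)
    (f : V -> W) : Prop :=
  forall (vs : seq V) (x : V), U x ->
    differentiable (foldr (fun v g => fun y => 'D_v g y) f vs) x.

(* The atlas need not be maximal; it may be, so quantifying over the charts of
   an arbitrary atlas covers all local coordinate systems.  The maps chart_map
   and chart_inv are total but only relevant on chart_dom c and chart_img c. *)
Record smooth_manifold (R : realType) (n : nat) := SmoothManifold {
  points :> topologicalType;
  points_hausdorff : hausdorff_space points;
  points_second_countable : @second_countable points;
  chart : Type;
  chart_dom : chart -> set points;
  chart_map : chart -> points -> 'rV[R]_n;
  chart_inv : chart -> 'rV[R]_n -> points;
  chart_img := fun c => chart_map c @` chart_dom c;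
  chart_dom_open : forall c, open (chart_dom c);
  chart_img_open : forall c, open (chart_img c);
  chart_mapK : forall c, {in chart_dom c, cancel (chart_map c) (chart_inv c)};
  chart_map_continuous : forall c,
    {within chart_dom c, continuous (chart_map c)};
  chart_inv_continuous : forall c,
    {within chart_img c, continuous (chart_inv c)};
  chart_cover : forall q : points, exists c, chart_dom c q;
  chart_transition_smooth : forall c d,
    smooth_on (chart_map c @` (chart_dom c `&` chart_dom d))
              (chart_map d \o chart_inv c)
}.

(* A function on T^*U in the induced coordinates (x^i, p_i). *)
Definition cofun (R : realType) (n : nat) := 'rV[R]_n -> 'rV[R]_n -> R.

(* A real function on T^*M is given by its expressions K c in the coordinates
   induced by the charts c, which must agree under the change of coordinates of
   covectors p_i = p'_j (dx'^j / dx^i).  The library's jacobian acts on row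
   vectors, i.e. ('J f x) i j = df^j/dx^i, whence the transpose. *)
Definition cotangent_function (R : realType) (n : nat)
    (M : smooth_manifold R n) (K : chart M -> cofun R n) : Prop :=
  forall (c d : chart M) (q : M) (p' : 'rV[R]_n),
    chart_dom c q -> chart_dom d q ->
    K c (chart_map c q)
        (p' *m ('J (chart_map d \o chart_inv c) (chart_map c q))^T)
    = K d (chart_map d q) p'.

(* \dot\partial^i = d/dp_i *)
Definition dotd (R : realType) (n : nat) (i : 'I_n) (F : cofun R n) :
    cofun R n :=
  fun x p => 'D_(delta_mx 0 i : 'rV[R]_n) (F x) p.

Section CartanTensors.
Variables (R : realType) (n : nat) (K : cofun R n).
Implicit Types (h i j k r s : 'I_n) (x p : 'rV[R]_n).

Definition gup x p : 'M[R]_n :=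
  \matrix_(i, j) (2^-1 * dotd i (dotd j (fun x p => K x p ^+ 2)) x p).

Definition glow x p : 'M[R]_n := invmx (gup x p).

Definition lup i : cofun R n := dotd i K.

Definition Cup i j k : cofun R n :=
  fun x p => - 2^-1 * dotd k (fun x p => gup x p i j) x p.

(* C_i^{jk} *)
Definition Cmix i j k : cofun R n :=
  fun x p => \sum_s glow x p i s * Cup s j k x p.

(* C^{hij}|^k *)
Definition Cvder h i j k : cofun R n :=
  fun x p => dotd k (Cup h i j) x p
    + \sum_r Cup r i j x p * Cmix r h k x p
    + \sum_r Cup h r j x p * Cmix r i k x p
    + \sum_r Cup h i r x p * Cmix r j k x p.

Definition Ttensor h i j k : cofun R n :=
  fun x p => K x p * Cvder h i j k x p
    + lup h x p * Cup i j k x p + lup i x p * Cup j k h x p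
    + lup j x p * Cup k h i x p + lup k x p * Cup h i j x p.

End CartanTensors.

Definition is_cartan_space (R : realType) (n : nat) (M : smooth_manifold R n)
    (K : chart M -> cofun R n) : Prop :=
  cotangent_function K /\
  forall c : chart M,
    [/\ smooth_on [set z : 'rV[R]_n * 'rV[R]_n | chart_img c z.1 /\ z.2 != 0]
          (fun z => K c z.1 z.2 : R^o),
        (forall x, chart_img c x ->
          {for (x, 0 : 'rV[R]_n), continuous (fun z => K c z.1 z.2)}),
        (forall x p, chart_img c x -> p != 0 -> 0 < K c x p),
        (forall x p (l : R), chart_img c x -> 0 < l ->
          K c x (l *: p) = l * K c x p) &
        (forall x p, chart_img c x -> p != 0 ->
          forall v : 'rV[R]_n, v != 0 ->
            0 < (v *m gup (K c) x p *m v^T) 0 0)].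

Section RootMetric.
Variables (R : realType) (n m : nat).
(* the coefficients a^{i_1 ... i_m}(x) *)
Variable a : 'rV[R]_n -> m.-tuple 'I_n -> R.
Implicit Types (s : seq 'I_n) (x p : 'rV[R]_n).

(* For s = [:: i_1; ...; i_r], r <= m, this is
   a^{i_1 ... i_r i_{r+1} ... i_m}(x) p_{i_{r+1}} ... p_{i_m}: the sum runs
   over the multi-indices t that start with s. *)
Definition contract s x p : R :=
  \sum_(t : m.-tuple 'I_n | prefix s t)
    a x t * \prod_(i <- drop (size s) t) p 0 i.

(* The normalized contractions a^i, a^{ij}, a^{ijk}, a^{hijk}, according to
   the length of s. *)
Definition aup (K : cofun R n) s x p : R :=
  contract s x p / K x p ^+ (m - size s).

Definition amx (K : cofun R n) x p : 'M[R]_n :=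
  \matrix_(i, j) aup K [:: i; j] x p.

(* a_i^{jk} *)
Definition amix (K : cofun R n) (i j k : 'I_n) x p : R :=
  \sum_s invmx (amx K x p) i s * aup K [:: s; j; k] x p.

End RootMetric.

(* Since K >= 0, the root in K = (a^{i_1...i_m} p_{i_1}...p_{i_m})^{1/m} is the
   nonnegative root of a nonnegative number; powR has a junk value at a
   negative first argument, hence the explicit nonnegativity. *)
Definition is_mth_root_metric (R : realType) (n m : nat)
    (M : smooth_manifold R n) (K : chart M -> cofun R n)
    (a : chart M -> 'rV[R]_n -> m.-tuple 'I_n -> R) : Prop :=
  forall (c : chart M) (x : 'rV[R]_n), chart_img c x ->
    (forall s t : m.-tuple 'I_n, perm_eq s t -> a c x s = a c x t) /\
    (forall p : 'rV[R]_n, 0 <= contract (a c) [::] x p /\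
      K c x p = powR (contract (a c) [::] x p) (m%:R^-1)).

(* Main.v *)
(* By symmetry of the coefficients, the normalized contractions satisfy
     dotd^k a^{i_1..i_r} = (m - r)/K (a^{i_1..i_r k} - a^{i_1..i_r} a^k),
   and l^i = a^i.  Hence g^{ij} = (m-1) a^{ij} - (m-2) a^i a^j, and C^{hij} and its
   derivatives are polynomials in the contractions divided by powers of K.  Euler's
   relation a^{r i_1..i_s} p_r/K = a^{i_1..i_s} gives p_i/K = a_{ij} a^j, so
   (m-1) g_{ij} = a_{ij} + (m-2) p_i p_j/K^2 by a rank-one inversion, and it kills
   the contraction of C^{rij} with p_r; thus raising and lowering indices of C
   with g is the same, up to the factor m-1, as with a^{ij}.  The formula is then
   a rational identity. *)
Require Import Defs.
From HB Require Import structures.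
From mathcomp Require Import all_boot all_order all_algebra.
From mathcomp Require Import all_classical all_reals all_analysis.
From mathcomp Require Import ring.
Import Order.TTheory GRing.Theory Num.Theory.
Import numFieldNormedType.Exports.
Local Open Scope ring_scope.

(** * Contractions of the symmetric coefficients *)

Lemma prefix_rconsE {T : eqType} (x0 : T) (s t : seq T) (y : T) :
  (size s < size t)%N ->
  prefix (rcons s y) t = prefix s t && (nth x0 t (size s) == y).
Proof.
by move=> lt_s_t; rewrite !prefixE size_rcons (take_nth x0)// eqseq_rcons.
Qed.

(** The multi-indices that start with [s] are sorted by their next entry [i], which contributes the
    factor [p 0 i]. *)
Lemma contractE {R : realType} {n m : nat} (a : 'rV[R]_n -> m.-tuple 'I_n -> R)
    (s : seq 'I_n) (x p : 'rV[R]_n) : (size s < m)%N ->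
  Defs.contract a s x p = \sum_i p 0 i * Defs.contract a (rcons s i) x p.
Proof.
move=> lt_s_m; rewrite /Defs.contract.
(* A tuple [t0] supplies the default entry for [nth]; if there is none, all sums are empty. *)
have [t0 _|nt] := pickP (fun t : m.-tuple 'I_n => prefix s t); last first.
  rewrite big_pred0// big1// => i _; rewrite big_pred0 ?mulr0// => t.
  apply/negbTE/negP => /(prefix_trans (prefix_rcons s i)).
  by rewrite nt.
pose y0 := tnth t0 (Ordinal lt_s_m).
rewrite (partition_big (fun t : m.-tuple 'I_n => nth y0 t (size s)) predT)//=.
apply: eq_bigr => i _; rewrite mulr_sumr; apply: eq_big => [t|t].
  by rewrite (prefix_rconsE y0) ?size_tuple.
move=> /andP[_ /eqP ti]; rewrite (drop_nth y0) ?size_tuple// ti big_cons.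
by rewrite size_rcons mulrCA.
Qed.

(** The symmetry hypothesis only concerns full multi-indices. By induction on the number of free
    slots, [contractE] appends the same index to both lists until they have length [m]. *)
Lemma contract_perm {R : realType} {n m : nat}
    (a : 'rV[R]_n -> m.-tuple 'I_n -> R) (x p : 'rV[R]_n) (s s' : seq 'I_n) :
  (forall t t' : m.-tuple 'I_n, perm_eq t t' -> a x t = a x t') ->
  perm_eq s s' -> Defs.contract a s x p = Defs.contract a s' x p.
Proof.
move=> asym; have [w] := ubnP (m - size s)%N.
elim: w s s' => // w IHw s s'; rewrite ltnS => le_w ss'.
have eq_sz := perm_size ss'.
have [lt_s_m|le_m_s] := ltnP (size s) m.
  rewrite contractE// [RHS]contractE -?eq_sz//; apply: eq_bigr => i _.
  congr (_ * _); apply: IHw; last by rewrite -!cats1 perm_cat2r.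
  by rewrite size_rcons subnS (leq_trans _ le_w)// prednK// subn_gt0.
(* A list longer than [m] is a prefix of no tuple, so both sums vanish. *)
have [eq_s|ne_s] := eqVneq (size s) m; last first.
  rewrite /Defs.contract !big_pred0// => t; apply/negbTE/negP => /size_prefix;
    by rewrite -?eq_sz size_tuple leqNgt ltn_neqAle eq_sym ne_s le_m_s.
have contract_full (u : seq 'I_n) (szu : size u == m) :
    Defs.contract a u x p = a x (Tuple szu).
  rewrite /Defs.contract (big_pred1 (Tuple szu)) => [|t].
    by rewrite drop_oversize//= big_nil mulr1.
  by rewrite prefixE (eqP szu) take_oversize ?size_tuple//.
have sz_s : size s == m by rewrite eq_s.
have sz_s' : size s' == m by rewrite -eq_sz eq_s.
by rewrite (contract_full s sz_s) (contract_full s' sz_s'); exact: asym.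
Qed.

(** * Momentum derivatives of the contractions *)

Lemma is_derive_coord {R : realType} {n : nat} (p : 'rV[R]_n) (i j : 'I_n) :
  is_derive p (delta_mx 0 i : 'rV[R]_n) (fun q : 'rV[R]_n => q 0 j : R)
    ((i == j)%:R).
Proof.
have @f : {linear 'rV[R]_n -> R}.
  by exists (fun q : 'rV[R]_n => q 0 j); do 2![eexists]; do ?[constructor];
     rewrite ?mxE// => ? *; rewrite ?mxE//; move=> ?; rewrite !mxE.
have cf : continuous f by exact: coord_continuous.
apply: DeriveDef; first exact/diff_derivable/differentiable_coord.
rewrite deriveE; last exact: differentiable_coord.
by rewrite (@diff_lin _ _ _ f)//= /f/= !mxE eqxx eq_sym.
Qed.

(** Induction on the free slots through [contractE]: in the product rule the derivative of [p_j]
    yields one copy of the contraction with [i] appended, and the other summand, contracted again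
    with [p_j], yields [m - size s - 1] more. *)
Lemma is_derive_contract {R : realType} {n m : nat}
    (a : 'rV[R]_n -> m.-tuple 'I_n -> R) (x p : 'rV[R]_n) (s : seq 'I_n)
    (i : 'I_n) :
  (forall t t' : m.-tuple 'I_n, perm_eq t t' -> a x t = a x t') ->
  is_derive p (delta_mx 0 i : 'rV[R]_n) (Defs.contract a s x : 'rV[R]_n -> R)
    ((m - size s)%:R * Defs.contract a (rcons s i) x p).
Proof.
move=> asym; have [w] := ubnP (m - size s)%N.
elim: w s => // w IHw s; rewrite ltnS => le_w.
(* If no momentum is left, the truncated difference [m - size s] is 0. *)
have [lt_s_m|le_m_s] := ltnP (size s) m; last first.
  have -> : Defs.contract a s x = cst (Defs.contract a s x 0).
    apply/funext => q; rewrite /Defs.contract; apply: eq_bigr => t _.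
    by rewrite drop_oversize ?size_tuple// !big_nil.
  apply: is_derive_eq; rewrite (eqP le_m_s) mul0r//.
have -> : Defs.contract a s x =
    \sum_j ((fun q : 'rV[R]_n => q 0 j) * Defs.contract a (rcons s j) x).
  by apply/funext => q; rewrite contractE// fct_sumE.
have Dc j : is_derive p (delta_mx 0 i : 'rV[R]_n)
    (Defs.contract a (rcons s j) x : 'rV[R]_n -> R)
    ((m - (size s).+1)%:R * Defs.contract a (rcons (rcons s j) i) x p).
  rewrite -(size_rcons s j); apply: IHw.
  by rewrite size_rcons subnS (leq_trans _ le_w)// prednK// subn_gt0.
have Dx j := is_derive_coord p i j.
apply: is_derive_eq; rewrite big_split/= addrC (bigD1 i)//= eqxx.
rewrite [in X in _ + X + _]big1 => [|j /negPf ji]; last first.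
  by rewrite eq_sym ji scaler0.
rewrite addr0 /GRing.scale/= mulr1.
have swap j : Defs.contract a (rcons (rcons s j) i) x p
            = Defs.contract a (rcons (rcons s i) j) x p.
  apply: contract_perm => //; rewrite -!cats1 -!catA perm_cat2l.
  by rewrite perm_catC.
under eq_bigr do rewrite mulrCA swap.
rewrite -mulr_sumr subnS.
(* If appending [i] fills the list, [contractE] no longer applies, but the remaining sum has
   coefficient 0. *)
have [eq_m|ne_m] := eqVneq (size s).+1 m.
  have -> : (m - size s = 1)%N by rewrite -eq_m subSnn.
  by rewrite mul0r addr0 mul1r.
rewrite -contractE ?size_rcons; last by rewrite ltn_neqAle ne_m.
rewrite -[in RHS](@prednK (m - size s)) ?subn_gt0//.
by rewrite -[in RHS]natr1 mulrDl mul1r addrC.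
Qed.

(* What the proof uses of an m-th root Cartan space, at the points of a single
   fibre T*_x M. *)
Record mth_root_fibre {R : realType} {n m : nat} (K : cofun R n)
    (a : 'rV[R]_n -> m.-tuple 'I_n -> R) (x : 'rV[R]_n) : Prop :=
  MthRootFibre {
  coef_sym : forall t t' : m.-tuple 'I_n, perm_eq t t' -> a x t = a x t';
  fibre_gt0 : forall p : 'rV[R]_n, p != 0 -> 0 < K x p;
  fibre_expr : forall p : 'rV[R]_n, K x p ^+ m = Defs.contract a [::] x p;
  fibre_diff : forall p : 'rV[R]_n, p != 0 ->
    differentiable (K x : 'rV[R]_n -> R) p
}.
Arguments coef_sym {R n m K a x}.
Arguments fibre_gt0 {R n m K a x}.
Arguments fibre_expr {R n m K a x}.
Arguments fibre_diff {R n m K a x}.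

(** * Momentum derivatives of [K] and of the normalized contractions *)

(** The relation between [K^m] and the full contraction is differentiated and divided by
    [m K^(m-1)], so no derivative of a root is taken. *)
Lemma is_derive_root {R : realType} {n m : nat} {K : cofun R n}
    {a : 'rV[R]_n -> m.-tuple 'I_n -> R} {x : 'rV[R]_n} (p : 'rV[R]_n)
    (i : 'I_n) :
  (0 < m)%N -> mth_root_fibre K a x -> p != 0 ->
  is_derive p (delta_mx 0 i : 'rV[R]_n) (K x : 'rV[R]_n -> R)
    (aup a K [:: i] x p).
Proof.
move=> m_gt0 Kx p0; have K_gt0 := fibre_gt0 Kx p p0.
have dK : derivable (K x : 'rV[R]_n -> R) p (delta_mx 0 i : 'rV[R]_n).
  exact/diff_derivable/(fibre_diff Kx).
apply: DeriveDef => //; rewrite /aup /= subn1.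
have Km : (K x : 'rV[R]_n -> R) ^+ m = Defs.contract a [::] x.
  by apply/funext => q; rewrite -(fibre_expr Kx) exprfctE.
have := deriveX m dK; rewrite Km.
have Dc := is_derive_contract a x p [::] i (coef_sym Kx).
rewrite derive_val /= subn0 -[_ *: _]mulrA => eqDK.
have m0 : m%:R != 0 :> R by rewrite pnatr_eq0 -lt0n.
rewrite (mulfI m0 eqDK) mulrC mulKf//.
by rewrite expf_neq0// gt_eqF.
Qed.

Lemma is_derive_aup {R : realType} {n m : nat} {K : cofun R n}
    {a : 'rV[R]_n -> m.-tuple 'I_n -> R} {x : 'rV[R]_n} (p : 'rV[R]_n)
    (s : seq 'I_n) (i : 'I_n) :
  (size s < m)%N -> mth_root_fibre K a x -> p != 0 ->
  is_derive p (delta_mx 0 i : 'rV[R]_n) (aup a K s x : 'rV[R]_n -> R)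
    ((m - size s)%:R / K x p *
      (aup a K (rcons s i) x p - aup a K s x p * aup a K [:: i] x p)).
Proof.
move=> lt_s_m Kx p0; have K_gt0 := fibre_gt0 Kx p p0.
have DK := is_derive_root p i (leq_ltn_trans (leq0n _) lt_s_m) Kx p0.
have Dc := is_derive_contract a x p s i (coef_sym Kx).
have K0 : K x p != 0 by rewrite gt_eqF.
have KX0 : ((K x : 'rV[R]_n -> R) ^+ (m - size s)) p != 0.
  by rewrite exprfctE expf_neq0.
have DV : is_derive p (delta_mx 0 i : 'rV[R]_n)
    (fun q => (((K x : 'rV[R]_n -> R) ^+ (m - size s)) q)^-1)
    (- (K x p ^+ (m - size s)) ^- 2
     *: (((m - size s)%:R * K x p ^+ (m - size s).-1) *: aup a K [:: i] x p)).
  apply: DeriveDef; first by apply: derivableV => //; exact: derivableX.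
  by rewrite deriveV// derive_val exprfctE.
have aupE : aup a K s x = (Defs.contract a s x : 'rV[R]_n -> R) *
    (fun q => (((K x : 'rV[R]_n -> R) ^+ (m - size s)) q)^-1).
  by apply/funext => q; rewrite [RHS]/= /aup; congr (_ / _); rewrite exprfctE.
rewrite [X in is_derive _ _ X]aupE.
apply: is_derive_eq; rewrite /GRing.scale/=.
move: (aup a K [:: i] x p) => l; rewrite /aup size_rcons /=.
rewrite exprfctE.
have -> : (m - (size s).+1 = (m - size s).-1)%N by rewrite subnS.
have : (0 < m - size s)%N by rewrite subn_gt0.
(* The exponent becomes [w.+1] and its predecessor [w], so that [field] can cancel [K^w]. *)
case: (m - size s)%N => // w _; rewrite (exprS _ w)/=.
have Kw : K x p ^+ w != 0 by rewrite expf_neq0.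
by field; rewrite ?K0 ?Kw.
Qed.

(** The closed forms below hold only at nonzero momenta; these form an open set, so the forms may
    still be differentiated there. *)
Lemma dotd_nonzero {R : realType} {n : nat} (F : cofun R n) (G : 'rV[R]_n -> R)
    (x p : 'rV[R]_n) (i : 'I_n) (dG : R) :
  (forall q : 'rV[R]_n, q != 0 -> F x q = G q) -> p != 0 ->
  is_derive p (delta_mx 0 i : 'rV[R]_n) G dG -> dotd i F x p = dG.
Proof.
move=> FG p0 [_ <-]; rewrite /dotd; apply: near_eq_derive.
have : nbhs p (~` [set 0 : 'rV[R]_n])%classic.
  apply: open_nbhs_nbhs; split; last exact/eqP.
  apply: closed_openC; apply: accessible_closed_set1.
  exact/hausdorff_accessible/norm_hausdorff.
by apply: filterS => q /eqP; exact: FG.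
Qed.

(** * Metric tensor, Cartan tensor and its momentum derivative *)

Lemma aup_perm {R : realType} {n m : nat} {K : cofun R n}
    {a : 'rV[R]_n -> m.-tuple 'I_n -> R} {x p : 'rV[R]_n} (s s' : seq 'I_n) :
  mth_root_fibre K a x -> perm_eq s s' -> aup a K s x p = aup a K s' x p.
Proof.
move=> Kx ss'; rewrite /aup (perm_size ss').
by rewrite (contract_perm _ _ _ _ s' (coef_sym Kx)).
Qed.

(** Since [K] has derivatives [a^i], half the second derivative of [K^2] is [K] times the derivative
    of [a^j], plus [a^i a^j]. *)
Lemma gup_root {R : realType} {n m : nat} {K : cofun R n}
    {a : 'rV[R]_n -> m.-tuple 'I_n -> R} {x p : 'rV[R]_n} (i j : 'I_n) :
  (1 < m)%N -> mth_root_fibre K a x -> p != 0 ->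
  gup K x p i j = (m%:R - 1) * aup a K [:: i; j] x p
                - (m%:R - 2) * (aup a K [:: i] x p * aup a K [:: j] x p).
Proof.
move=> m_gt1 Kx p0; rewrite mxE.
have DK q l q0 := is_derive_root q l (ltnW m_gt1) Kx q0.
have DK2 q : q != 0 ->
    dotd j (fun x p => K x p ^+ 2) x q = 2 * K x q * aup a K [:: j] x q.
  move=> q0; have DKq := DK q j q0.
  apply: (dotd_nonzero _ ((K x : 'rV[R]_n -> R) ^+ 2) _ _ _ _ _ q0).
  by move=> r _; rewrite exprfctE.
have DKp := DK p i p0.
have DA := is_derive_aup p [:: j] i m_gt1 Kx p0.
rewrite (dotd_nonzero _ (2 \*: ((K x : 'rV[R]_n -> R) * aup a K [:: j] x))
  x p i (2 * (K x p * ((m - 1)%:R / K x p *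
    (aup a K [:: j; i] x p - aup a K [:: j] x p * aup a K [:: i] x p))
    + aup a K [:: j] x p * aup a K [:: i] x p)) _ p0).
- have K0 : K x p != 0 by rewrite gt_eqF// (fibre_gt0 Kx).
  rewrite (aup_perm [:: j; i] [:: i; j] Kx) ?(perm_catC [:: j] [:: i])//.
  by rewrite natrB 1?ltnW//; field.
- by move=> q q0; rewrite DK2// -mulrA.
Qed.

(** The totally symmetric bracket of [C^{ijk}] that remains once its scalar factor is taken out. *)
Definition root_cubic {R : realType} {n m : nat}
    (a : 'rV[R]_n -> m.-tuple 'I_n -> R) (K : cofun R n) (i j k : 'I_n) :
    cofun R n := fun x p =>
  let A s := aup a K s x p in
  A [:: i; j; k] - A [:: i; j] * A [:: k] - A [:: i; k] * A [:: j]
  - A [:: j; k] * A [:: i] + 2 * (A [:: i] * A [:: j] * A [:: k]).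

Lemma Cup_root {R : realType} {n m : nat} {K : cofun R n}
    {a : 'rV[R]_n -> m.-tuple 'I_n -> R} {x p : 'rV[R]_n} (i j k : 'I_n) :
  (2 < m)%N -> mth_root_fibre K a x -> p != 0 ->
  Cup K i j k x p = - ((m%:R - 1) * (m%:R - 2) / 2) / K x p
                    * root_cubic a K i j k x p.
Proof.
move=> m_gt2 Kx p0; rewrite /Cup.
have m_gt1 := ltnW m_gt2; have m_gt0 := ltnW m_gt1.
have Dij := is_derive_aup p [:: i; j] k m_gt2 Kx p0.
have Di := is_derive_aup p [:: i] k m_gt1 Kx p0.
have Dj := is_derive_aup p [:: j] k m_gt1 Kx p0.
(* The reflexivity proof leaves the value of the derivative to be inferred from the instances in the
   context. *)
rewrite (dotd_nonzero _ ((m%:R - 1) \*: aup a K [:: i; j] x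
    - (m%:R - 2) \*: ((aup a K [:: i] x : 'rV[R]_n -> R) * aup a K [:: j] x))
  x p k _ _ p0 (is_derive_eq _ (erefl _))); last first.
  by move=> q q0; rewrite (gup_root _ _ m_gt1 Kx q0).
have K0 : K x p != 0 by rewrite gt_eqF// (fibre_gt0 Kx).
rewrite /root_cubic /GRing.scale/= !natrB//.
by field.
Qed.

(* [D1 i], [D2 i j], [D3 h i j] are [K] times the [k]-th momentum derivatives of
   a^i, a^{ij}, a^{hij}. *)
Lemma dotd_Cup_root {R : realType} {n m : nat} {K : cofun R n}
    {a : 'rV[R]_n -> m.-tuple 'I_n -> R} {x p : 'rV[R]_n} (h i j k : 'I_n) :
  (3 < m)%N -> mth_root_fibre K a x -> p != 0 ->
  let A s := aup a K s x p in
  let D1 i := (m%:R - 1) * (A [:: i; k] - A [:: i] * A [:: k]) in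
  let D2 i j := (m%:R - 2) * (A [:: i; j; k] - A [:: i; j] * A [:: k]) in
  let D3 h i j :=
    (m%:R - 3) * (A [:: h; i; j; k] - A [:: h; i; j] * A [:: k]) in
  dotd k (Cup K h i j) x p = - ((m%:R - 1) * (m%:R - 2) / 2) / K x p ^+ 2 *
    (D3 h i j - (D2 h i * A [:: j] + A [:: h; i] * D1 j)
     - (D2 h j * A [:: i] + A [:: h; j] * D1 i)
     - (D2 i j * A [:: h] + A [:: i; j] * D1 h)
     + 2 * (D1 h * A [:: i] * A [:: j] + A [:: h] * D1 i * A [:: j]
            + A [:: h] * A [:: i] * D1 j)
     - A [:: k] * root_cubic a K h i j x p).
Proof.
move=> m_gt3 Kx p0 A D1 D2 D3.
have m_gt2 := ltnW m_gt3; have m_gt1 := ltnW m_gt2; have m_gt0 := ltnW m_gt1.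
have K0 : K x p != 0 by rewrite gt_eqF// (fibre_gt0 Kx).
have DK := is_derive_root p k m_gt0 Kx p0.
(* The factor [1/K] of the Cartan tensor produces the last term, [a^k] times the cubic bracket. *)
have DV : is_derive p (delta_mx 0 k : 'rV[R]_n)
    (fun q : 'rV[R]_n => (K x q)^-1 : R)
    (- K x p ^- 2 *: aup a K [:: k] x p).
  apply: DeriveDef; first exact: derivableV.
  by rewrite deriveV// derive_val.
have Ds1 l := is_derive_aup p [:: l] k m_gt1 Kx p0.
have Ds2 l l' := is_derive_aup p [:: l; l'] k m_gt2 Kx p0.
have Ds3 := is_derive_aup p [:: h; i; j] k m_gt3 Kx p0.
pose f s : 'rV[R]_n -> R := aup a K s x.
rewrite (dotd_nonzero _ (- ((m%:R - 1) * (m%:R - 2) / 2) \*: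
    ((fun q : 'rV[R]_n => (K x q)^-1 : R) *
     (f [:: h; i; j] - f [:: h; i] * f [:: j] - f [:: h; j] * f [:: i]
      - f [:: i; j] * f [:: h] + 2 \*: (f [:: h] * f [:: i] * f [:: j]))))
  x p k _ _ p0 (is_derive_eq _ (erefl _))); last first.
  by move=> q q0; rewrite (Cup_root _ _ _ m_gt2 Kx q0) -mulrA.
rewrite /D3 /D2 /D1 /A /root_cubic /GRing.scale/= !natrB//.
by rewrite /f !fctE /= /GRing.scale/=; field.
Qed.

(** * Inverse metric and Euler's relation *)

(** A case of the Sherman-Morrison formula: as [u *m invmx G *m u^T] is 1, its denominator is
    [b^-1]. *)
Lemma invmx_rank1_update {F : fieldType} {n : nat} (G : 'M[F]_n)
    (u q : 'rV[F]_n) (b : F) :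
  G \in unitmx -> G *m q^T = u^T -> u *m q^T = 1%:M -> u = q *m G -> b != 0 ->
  invmx (b *: G - (b - 1) *: (u^T *m u))
  = b^-1 *: (invmx G + (b - 1) *: (q^T *m q)).
Proof.
move=> Gu Gq uq qG b0; set X := _ - _; set Y := _ *: _.
have uG : u *m invmx G = q by rewrite qG mulmxK.
(* For square matrices a one-sided inverse also gives the invertibility of [X]. *)
suff XY : X *m Y = 1%:M.
  by have [Xu _] := mulmx1_unit XY; rewrite -[RHS](mulKmx Xu) XY mulmx1.
rewrite /X /Y -scalemxAr mulmxBl !mulmxDr -!scalemxAl -!scalemxAr mulmxV//.
rewrite (mulmxA G) Gq -!(mulmxA u^T) uG (mulmxA u) uq mul1mx.
move: (u^T *m q) => Z.
apply/matrixP => i j; rewrite !mxE.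
by field.
Qed.

Lemma aup_nil {R : realType} {n m : nat} {K : cofun R n}
    {a : 'rV[R]_n -> m.-tuple 'I_n -> R} {x p : 'rV[R]_n} :
  mth_root_fibre K a x -> p != 0 -> aup a K [::] x p = 1.
Proof.
move=> Kx p0; rewrite /aup subn0 -(fibre_expr Kx) divff//.
by rewrite expf_neq0// gt_eqF// (fibre_gt0 Kx).
Qed.

(** This is [contractE] divided by a power of [K], with the summation index moved to the front by
    symmetry. *)
Lemma aup_euler {R : realType} {n m : nat} {K : cofun R n}
    {a : 'rV[R]_n -> m.-tuple 'I_n -> R} {x p : 'rV[R]_n} (s : seq 'I_n) :
  (size s < m)%N -> mth_root_fibre K a x -> p != 0 ->
  \sum_r p 0 r / K x p * aup a K (r :: s) x p = aup a K s x p.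
Proof.
move=> lt_s_m Kx p0; have K0 : K x p != 0 by rewrite gt_eqF// (fibre_gt0 Kx).
rewrite [RHS]/aup contractE// mulr_suml; apply: eq_bigr => r _.
have -> : aup a K (r :: s) x p = aup a K (rcons s r) x p.
  by apply: (aup_perm _ _ Kx); rewrite perm_sym perm_rcons.
rewrite /aup size_rcons subnS.
have : (0 < m - size s)%N by rewrite subn_gt0.
case: (m - size s)%N => // w _; rewrite exprS /=.
by field; rewrite ?K0 ?expf_neq0.
Qed.

(** The weight [f] is arbitrary because it will be [p/K], a row of the inverse matrix, or the
    bracket of the mixed Cartan tensor. *)
Lemma sum_root_cubic {R : realType} {n m : nat} {K : cofun R n}
    {a : 'rV[R]_n -> m.-tuple 'I_n -> R} {x p : 'rV[R]_n} (f : 'I_n -> R)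
    (h k : 'I_n) :
  let A s := aup a K s x p in
  \sum_r f r * root_cubic a K r h k x p =
    \sum_r f r * A [:: r; h; k] - A [:: k] * \sum_r f r * A [:: r; h]
    - A [:: h] * \sum_r f r * A [:: r; k] - A [:: h; k] * \sum_r f r * A [:: r]
    + 2 * (A [:: h] * A [:: k] * \sum_r f r * A [:: r]).
Proof.
move=> A; rewrite !mulr_sumr -!sumrN -!big_split/=; apply: eq_bigr => r _.
by rewrite /root_cubic /A; ring.
Qed.

(** Reflects the 0-homogeneity of [g^{ij}] in the momenta; it makes the rank-one part of [glow]
    invisible to the Cartan tensor. *)
Lemma euler_root_cubic {R : realType} {n m : nat} {K : cofun R n}
    {a : 'rV[R]_n -> m.-tuple 'I_n -> R} {x p : 'rV[R]_n} (h k : 'I_n) :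
  (2 < m)%N -> mth_root_fibre K a x -> p != 0 ->
  \sum_r p 0 r / K x p * root_cubic a K r h k x p = 0.
Proof.
move=> m_gt2 Kx p0; have m_gt1 := ltnW m_gt2; have m_gt0 := ltnW m_gt1.
rewrite sum_root_cubic !aup_euler// (aup_nil Kx p0).
by ring.
Qed.

Lemma amx_sym {R : realType} {n m : nat} {K : cofun R n}
    {a : 'rV[R]_n -> m.-tuple 'I_n -> R} {x p : 'rV[R]_n} :
  mth_root_fibre K a x -> (amx a K x p)^T = amx a K x p.
Proof.
move=> Kx; apply/matrixP => i j; rewrite !mxE; apply: (aup_perm _ _ Kx).
by rewrite (perm_catC [:: j] [:: i]).
Qed.

(** For [p != 0], the point of the indicatrix [K = 1] on the ray through [p]; it serves as [q] in
    [invmx_rank1_update]. *)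
Definition unit_momentum {R : realType} {n : nat} (K : cofun R n)
    (x p : 'rV[R]_n) : 'rV[R]_n := (K x p)^-1 *: p.

Lemma unit_momentumE {R : realType} {n : nat} (K : cofun R n)
    (x p : 'rV[R]_n) r : unit_momentum K x p 0 r = p 0 r / K x p.
Proof. by rewrite mxE mulrC. Qed.

Lemma unit_momentum_amx {R : realType} {n m : nat} {K : cofun R n}
    {a : 'rV[R]_n -> m.-tuple 'I_n -> R} {x p : 'rV[R]_n} :
  (1 < m)%N -> mth_root_fibre K a x -> p != 0 ->
  unit_momentum K x p *m amx a K x p = \row_i aup a K [:: i] x p.
Proof.
move=> m_gt1 Kx p0; apply/rowP => i; rewrite !mxE -(aup_euler [:: i] m_gt1 Kx p0).
by apply: eq_bigr => r _; rewrite unit_momentumE mxE.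
Qed.

(** The rank-one update with [b = m - 1] and [u] the row of the [a^i]; its hypotheses are Euler's
    relation for one index and for none. *)
Lemma glow_root {R : realType} {n m : nat} {K : cofun R n}
    {a : 'rV[R]_n -> m.-tuple 'I_n -> R} {x p : 'rV[R]_n} :
  (1 < m)%N -> mth_root_fibre K a x -> p != 0 -> amx a K x p \in unitmx ->
  glow K x p = (m%:R - 1)^-1 *:
    (invmx (amx a K x p) + (m%:R - 2) *:
       ((unit_momentum K x p)^T *m unit_momentum K x p)).
Proof.
move=> m_gt1 Kx p0 Gu; have m_gt0 := ltnW m_gt1.
pose u : 'rV[R]_n := \row_i aup a K [:: i] x p.
pose q := unit_momentum K x p.
have qG : q *m amx a K x p = u := unit_momentum_amx m_gt1 Kx p0.
have -> : m%:R - 2 = m%:R - 1 - 1 :> R by ring.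
rewrite -(invmx_rank1_update _ u) //; last 3 first.
- by rewrite -qG trmx_mul (amx_sym Kx).
- apply/matrixP => i j; rewrite !ord1 !mxE eqxx -(aup_nil Kx p0).
  rewrite -(aup_euler [::] m_gt0 Kx p0); apply: eq_bigr => r _.
  by rewrite [X in _ * X]mxE -/q unit_momentumE mxE mulrC.
- by rewrite subr_eq0 (eqr_nat R m 1) gtn_eqF.
congr invmx; apply/matrixP => i j; rewrite (gup_root _ _ m_gt1 Kx p0) !mxE.
rewrite big_ord1 !mxE; ring.
Qed.

(** * Mixed Cartan tensor and its contraction with the Cartan tensor *)

(** By [euler_root_cubic] only the inverse of [amx] survives from [glow]. It turns [a^s] into
    [p_r/K] and [a^{sl}] into a Kronecker delta, and the factor [m - 1] cancels. *)
Lemma Cmix_root {R : realType} {n m : nat} {K : cofun R n}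
    {a : 'rV[R]_n -> m.-tuple 'I_n -> R} {x p : 'rV[R]_n} (r h k : 'I_n) :
  (2 < m)%N -> mth_root_fibre K a x -> p != 0 -> amx a K x p \in unitmx ->
  let A s := aup a K s x p in
  let q r := p 0 r / K x p in
  Cmix K r h k x p = - ((m%:R - 2) / 2) / K x p *
    (amix a K r h k x p - A [:: h; k] * q r - (r == h)%:R * A [:: k]
     - (r == k)%:R * A [:: h] + 2 * (A [:: h] * A [:: k]) * q r).
Proof.
move=> m_gt2 Kx p0 Gu A q; have m_gt1 := ltnW m_gt2.
set N := invmx (amx a K x p).
have m10 : m%:R - 1 != 0 :> R by rewrite subr_eq0 (eqr_nat R m 1) gtn_eqF.
have NA1 : \sum_s N r s * A [:: s] = q r.
  have : (N *m (\row_i A [:: i])^T) r 0 = q r.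
    rewrite -(unit_momentum_amx m_gt1 Kx p0) trmx_mul (amx_sym Kx) mulKmx//.
    by rewrite mxE unit_momentumE.
  by rewrite mxE => <-; apply: eq_bigr => s _; rewrite !mxE.
have NA2 l : \sum_s N r s * A [:: s; l] = (r == l)%:R.
  have : (N *m amx a K x p) r l = (r == l)%:R by rewrite mulVmx// mxE.
  by rewrite mxE => <-; apply: eq_bigr => s _; rewrite !mxE.
rewrite /Cmix (glow_root m_gt1 Kx p0 Gu).
under eq_bigr => s _ do rewrite (Cup_root _ _ _ m_gt2 Kx p0).
transitivity (- ((m%:R - 2) / 2) / K x p *
    (\sum_s N r s * root_cubic a K s h k x p
     + (m%:R - 2) * q r * \sum_s q s * root_cubic a K s h k x p)).
  rewrite [(m%:R - 2) * q r * _]mulr_sumr -big_split mulr_sumr /=.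
  apply: eq_bigr => s _; rewrite !mxE big_ord1 !mxE -/N /q.
  by field; rewrite m10 gt_eqF// (fibre_gt0 Kx).
rewrite (euler_root_cubic _ _ m_gt2 Kx p0) sum_root_cubic.
rewrite !NA2 NA1 /amix -/N /A /q; ring.
Qed.

Lemma root_cubic_perm {R : realType} {n m : nat} {K : cofun R n}
    {a : 'rV[R]_n -> m.-tuple 'I_n -> R} {x p : 'rV[R]_n} (i j k : 'I_n) :
  mth_root_fibre K a x ->
  root_cubic a K i j k x p = root_cubic a K j i k x p /\
  root_cubic a K i j k x p = root_cubic a K k i j x p.
Proof.
move=> Kx; rewrite /root_cubic.
have P2 u v : aup a K [:: u; v] x p = aup a K [:: v; u] x p.
  by apply: (aup_perm _ _ Kx); rewrite (perm_catC [:: u] [:: v]).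
have -> : aup a K [:: j; i; k] x p = aup a K [:: i; j; k] x p.
  by apply: (aup_perm _ _ Kx); rewrite (perm_catCA [:: j] [:: i] [:: k]).
have -> : aup a K [:: k; i; j] x p = aup a K [:: i; j; k] x p.
  by apply: (aup_perm _ _ Kx); rewrite (perm_catC [:: k] [:: i; j]).
by rewrite (P2 j i) (P2 k i) (P2 k j); split; ring.
Qed.

(** The two moves generate all permutations; they bring the summation index in [Cvder] to the first
    slot. *)
Lemma Cup_root_perm {R : realType} {n m : nat} {K : cofun R n}
    {a : 'rV[R]_n -> m.-tuple 'I_n -> R} {x p : 'rV[R]_n} (i j k : 'I_n) :
  (2 < m)%N -> mth_root_fibre K a x -> p != 0 ->
  Cup K i j k x p = Cup K j i k x p /\ Cup K i j k x p = Cup K k i j x p.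
Proof.
move=> m_gt2 Kx p0; rewrite !(Cup_root _ _ _ m_gt2 Kx p0).
by have [<- <-] := root_cubic_perm (p := p) i j k Kx.
Qed.

(** Contracting [a_r^{hk}] with [a^r] or [a^{rl}] undoes the lowering and returns [a^{hk}] or
    [a^{lhk}]; only the contraction with [a^{rij}] stays unreduced. *)
Lemma sum_Cup_Cmix {R : realType} {n m : nat} {K : cofun R n}
    {a : 'rV[R]_n -> m.-tuple 'I_n -> R} {x p : 'rV[R]_n} (i j h k : 'I_n) :
  (2 < m)%N -> mth_root_fibre K a x -> p != 0 -> amx a K x p \in unitmx ->
  let A s := aup a K s x p in
  \sum_r Cup K r i j x p * Cmix K r h k x p =
    (m%:R - 1) * (m%:R - 2) ^+ 2 / 4 / K x p ^+ 2 *
    (\sum_r amix a K r h k x p * A [:: r; i; j] - A [:: i; j] * A [:: h; k]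
     - A [:: h; i; j] * A [:: k] - A [:: k; i; j] * A [:: h]
     + 2 * (A [:: h] * A [:: k]) * A [:: i; j]
     - A [:: j] * root_cubic a K i h k x p
     - A [:: i] * root_cubic a K j h k x p).
Proof.
move=> m_gt2 Kx p0 Gu A; have m_gt1 := ltnW m_gt2; have m_gt0 := ltnW m_gt1.
set N := invmx (amx a K x p); pose q r := p 0 r / K x p.
pose X r := amix a K r h k x p - A [:: h; k] * q r - (r == h)%:R * A [:: k]
     - (r == k)%:R * A [:: h] + 2 * (A [:: h] * A [:: k]) * q r.
have sum_delta (f : 'I_n -> R) l : \sum_r (r == l)%:R * f r = f l.
  rewrite (bigD1 l)//= eqxx mul1r big1 ?addr0// => r /negPf->.
  by rewrite mul0r.
have sumX (f : 'I_n -> R) : \sum_r X r * f r =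
    \sum_r amix a K r h k x p * f r - A [:: h; k] * \sum_r q r * f r
    - A [:: k] * f h - A [:: h] * f k
    + 2 * (A [:: h] * A [:: k]) * \sum_r q r * f r.
  rewrite -(sum_delta f h) -(sum_delta f k) !mulr_sumr -!sumrN -!big_split/=.
  by apply: eq_bigr => r _; rewrite /X; ring.
(* Summing over [r] first lets the weight [f] meet the inverse matrix directly. *)
have sum_amix (f : 'I_n -> R) : \sum_r amix a K r h k x p * f r =
    \sum_s A [:: s; h; k] * \sum_r f r * N r s.
  under eq_bigr => r _ do rewrite /amix -/N mulr_suml.
  rewrite exchange_big; apply: eq_bigr => s _; rewrite mulr_sumr.
  by apply: eq_bigr => r _; rewrite /A; ring.
have amixA1 : \sum_r amix a K r h k x p * A [:: r] = A [:: h; k].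
  rewrite sum_amix -[RHS](aup_euler [:: h; k] m_gt2 Kx p0).
  apply: eq_bigr => s _; rewrite mulrC; congr (_ * _).
  have : ((\row_r A [:: r]) *m N) 0 s = q s.
    by rewrite -(unit_momentum_amx m_gt1 Kx p0) mulmxK// unit_momentumE.
  by rewrite -[p 0 s / _]/(q s) mxE => <-; apply: eq_bigr => r _; rewrite mxE.
have amixA2 l : \sum_r amix a K r h k x p * A [:: r; l] = A [:: l; h; k].
  rewrite sum_amix -[RHS](sum_delta (fun s => A [:: s; h; k])).
  apply: eq_bigr => s _; rewrite mulrC; congr (_ * _).
  have : (amx a K x p *m N) l s = (s == l)%:R by rewrite mulmxV// mxE eq_sym.
  rewrite mxE => <-; apply: eq_bigr => r _; congr (_ * _).
  by rewrite -(amx_sym Kx) !mxE.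
(* The constant is the product of the scalar factors of [Cup_root] and [Cmix_root], whose signs
   cancel. *)
transitivity ((m%:R - 1) * (m%:R - 2) ^+ 2 / 4 / K x p ^+ 2 *
    \sum_r X r * root_cubic a K r i j x p).
  rewrite mulr_sumr; apply: eq_bigr => r _.
  rewrite (Cup_root _ _ _ m_gt2 Kx p0) (Cmix_root _ _ _ m_gt2 Kx p0 Gu) /X /q /A.
  by field; rewrite gt_eqF// (fibre_gt0 Kx).
rewrite sum_root_cubic !sumX -!/(A _) amixA1 !amixA2.
rewrite (aup_euler [:: i; j] m_gt2 Kx p0) (aup_euler [::] m_gt0 Kx p0).
rewrite (aup_euler [:: i] m_gt1 Kx p0) (aup_euler [:: j] m_gt1 Kx p0).
rewrite (aup_nil Kx p0).
have P2 u v : A [:: u; v] = A [:: v; u].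
  by apply: (aup_perm _ _ Kx); rewrite (perm_catC [:: u] [:: v]).
rewrite /root_cubic -!/(A _) (P2 h i) (P2 h j) (P2 k i) (P2 k j).
by rewrite /A; ring.
Qed.

(** * Assembly of the T-tensor on a fibre *)

(** In units of [(m-1)(m-2)/(4K)], the term [a^{hij} a^k] receives [2(m-2)] from the derivative of
    [C^{hij}], [-3(m-2)] from the three quadratic sums and [-2] from [l^k C^{hij}], in total [-m].
    Products of three or four contractions cancel. *)
Lemma Ttensor_root {R : realType} {n m : nat} {K : cofun R n}
    {a : 'rV[R]_n -> m.-tuple 'I_n -> R} {x p : 'rV[R]_n} (h i j k : 'I_n) :
  (3 < m)%N -> mth_root_fibre K a x -> p != 0 -> amx a K x p \in unitmx ->
  let A s := aup a K s x p in
  let A_ r u v := amix a K r u v x p in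
  Ttensor K h i j k x p =
    - ((m%:R - 1) * (m%:R - 2) * (m%:R - 3) / (2 * K x p)) * A [:: h; i; j; k]
    + (m%:R - 1) * (m%:R - 2) ^+ 2 / (4 * K x p)
      * (\sum_r A_ r h k * A [:: r; i; j]
         + \sum_r A_ r i k * A [:: r; h; j]
         + \sum_r A_ r j k * A [:: r; h; i])
    - m%:R * (m%:R - 1) * (m%:R - 2) / (4 * K x p)
      * (A [:: h; i; j] * A [:: k] + A [:: h; j; k] * A [:: i]
         + A [:: i; j; k] * A [:: h] + A [:: h; i; k] * A [:: j]
         - A [:: i; j] * A [:: h; k] - A [:: h; j] * A [:: i; k]
         - A [:: i; h] * A [:: j; k]).
Proof.
move=> m_gt3 Kx p0 Gu A A_.
have m_gt2 := ltnW m_gt3; have m_gt1 := ltnW m_gt2; have m_gt0 := ltnW m_gt1.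
have K0 : K x p != 0 by rewrite gt_eqF// (fibre_gt0 Kx).
have lupE l : lup K l x p = A [:: l].
  by have Dl := is_derive_root p l m_gt0 Kx p0; rewrite /lup /dotd derive_val.
rewrite /Ttensor /Cvder !lupE.
rewrite (dotd_Cup_root _ _ _ _ m_gt3 Kx p0).
under [\sum_r Cup K h r j x p * _]eq_bigr => r _
  do rewrite (Cup_root_perm h r j m_gt2 Kx p0).1.
under [\sum_r Cup K h i r x p * _]eq_bigr => r _
  do rewrite (Cup_root_perm h i r m_gt2 Kx p0).2.
rewrite !(sum_Cup_Cmix _ _ _ _ m_gt2 Kx p0 Gu) !(Cup_root _ _ _ m_gt2 Kx p0).
rewrite /root_cubic -!/(A _).
have P2 u v : A [:: u; v] = A [:: v; u].
  by apply: (aup_perm _ _ Kx); rewrite (perm_catC [:: u] [:: v]).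
have P3 u v w : A [:: u; v; w] = A [:: v; u; w].
  by apply: (aup_perm _ _ Kx); rewrite (perm_catCA [:: u] [:: v] [:: w]).
have P3' u v w : A [:: w; u; v] = A [:: w; v; u].
  apply: (aup_perm _ _ Kx); rewrite (perm_cat2l [:: w] [:: u; v] [:: v; u]).
  by rewrite (perm_catC [:: u] [:: v]).
(* Sorting the indices makes symmetric components equal atoms for [field]. *)
rewrite !(P2 i h, P2 j h, P2 k h, P2 j i, P2 k i, P2 k j).
rewrite !(P3 i h, P3 j h, P3 k h, P3 j i, P3 k i, P3 k j,
          P3' i h, P3' j h, P3' k h, P3' j i, P3' k i, P3' k j).
by rewrite /A_ /A; field.
Qed.

(** * Passage from the Cartan space to a single fibre *)

Theorem theorem4p2 (R : realType) (n m : nat) (hn : (4 <= n)%N) (hm : (4 <= m)%N)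
    (M : smooth_manifold R n) (K : chart M -> cofun R n)
    (a : chart M -> 'rV[R]_n -> m.-tuple 'I_n -> R)
    (hK : is_cartan_space K) (hroot : is_mth_root_metric K a)
    (hinv : forall (c : chart M) (x p : 'rV[R]_n),
      chart_img c x -> p != 0 -> amx (a c) (K c) x p \in unitmx) :
  forall (c : chart M) (x p : 'rV[R]_n) (h i j k : 'I_n),
    chart_img c x -> p != 0 ->
    let Kp := K c x p in
    let A s := aup (a c) (K c) s x p in
    let A_ r u v := amix (a c) (K c) r u v x p in
    Ttensor (K c) h i j k x p =
      - ((m%:R - 1) * (m%:R - 2) * (m%:R - 3) / (2 * Kp)) * A [:: h; i; j; k]
      + (m%:R - 1) * (m%:R - 2) ^+ 2 / (4 * Kp)
        * (\sum_r A_ r h k * A [:: r; i; j]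
           + \sum_r A_ r i k * A [:: r; h; j]
           + \sum_r A_ r j k * A [:: r; h; i])
      - m%:R * (m%:R - 1) * (m%:R - 2) / (4 * Kp)
        * (A [:: h; i; j] * A [:: k] + A [:: h; j; k] * A [:: i]
           + A [:: i; j; k] * A [:: h] + A [:: h; i; k] * A [:: j]
           - A [:: i; j] * A [:: h; k] - A [:: h; j] * A [:: i; k]
           - A [:: i; h] * A [:: j; k]).
Proof.
move=> c x p h i j k xc p0 Kp A A_.
suff Kx : mth_root_fibre (K c) (a c) x.
  exact: Ttensor_root hm Kx p0 (hinv c x p xc p0).
have [_ /(_ c)[K_smooth _ K_gt0 _ _]] := hK.
have [a_sym K_root] := hroot c x xc.
split=> // [q|q|q q0]; first exact: K_gt0.
(* The [m]-th power of the root recovers its argument because that is nonnegative. *)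
- have [F_ge0 ->] := K_root q.
  rewrite -powR_mulrn ?powR_ge0// -powRrM mulVf ?powRr1//.
  by rewrite pnatr_eq0 -lt0n (leq_trans _ hm).
(* With an empty list of directions, smoothness is joint differentiability in position and momentum;
   composing with the inclusion of the fibre gives differentiability in the momentum. *)
- have K_diff := K_smooth [::] (x, q) (conj xc q0).
  have x_diff : differentiable (fun r : 'rV[R]_n => (x, r)) q.
    exact: differentiable_pair.
  exact: (differentiable_comp x_diff K_diff).
Qed.
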